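(* Let $\delta,\omega>0$, let $\Theta_\omega$ be the solution of $$\ddot{\Theta}_\omega+\frac1\omega\Theta_\omega+\frac1\omega\Theta_\omega^3=0,\qquad \Theta_\omega(0)=\delta,\ \dot\Theta_\omega(0)=0,$$ and let $$\Psi(\delta,\omega)=2\sqrt{2\omega}\int_0^{\pi/2}\sqrt{\frac{\omega+\delta^2\sin^2\theta}{2+\delta^2+\delta^2\sin^2\theta}}\;d\theta .$$ If there exists $\ell\in\mathbb{N}$ such that $$\log\Big(1+\frac{\delta^2}{\omega}\Big)<2\cdot\min\big\{\Psi(\delta,\omega)-\ell\pi,\ (\ell+1)\pi-\Psi(\delta,\omega)\big\},$$ then the trivial solution of $\ddot{\xi}(t)+\big(\omega+\Theta_\omega(t)^2\big)\xi(t)=0$ is stable and (when $\omega=n^2/m^2$ with $m\neq n$ positive integers) the nonlinear mode $\Theta_m$ with $\Theta_m(0)=\delta$, $\dot\Theta_m(0)=0$ is linearly stable with respect to $\Theta_n$.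
   Context: $\mathbb{N}$ includes $0$. The trivial solution $\xi\equiv0$ of a linear equation $\ddot\xi+p(t)\xi=0$ is called stable if all solutions are bounded on $\mathbb{R}$, and unstable otherwise. For an integer $m\ge1$ the nonlinear mode $\Theta_m$ with initial value $\delta$ is the solution of $\ddot{\Theta}_m+m^4\Theta_m+m^4\Theta_m^3=0$, $\Theta_m(0)=\delta$, $\dot\Theta_m(0)=0$. For integers $m,n\ge1$, $m\neq n$, the mode $\Theta_m$ is said to be linearly stable (unstable) with respect to the $n$-th mode $\Theta_n$ if $\xi\equiv0$ is a stable (unstable) solution of the linear Hill equation $$\ddot{\xi}(t)+\big(n^4+m^2n^2\Theta_m(t)^2\big)\xi(t)=0 .$$ The parameter $\omega$ associated with $(m,n)$ is $\omega=n^2/m^2$. *)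

(* Defs.v *)
From Stdlib Require Import Reals.
From Coquelicot Require Import Coquelicot.
Open Scope R_scope.

(* [ex_derive_n x 2 t] only says that the total function [Derive x] is
   differentiable at [t], so differentiability of [x] is required separately. *)
Definition twice_derivable (x : R -> R) : Prop :=
  forall t : R, ex_derive x t /\ ex_derive (Derive x) t.

Definition hill_solution (p : R -> R) (xi : R -> R) : Prop :=
  twice_derivable xi /\
  forall t : R, Derive_n xi 2 t + p t * xi t = 0.

Definition bounded_on_R (x : R -> R) : Prop :=
  exists M : R, forall t : R, Rabs (x t) <= M.

Definition trivial_solution_stable (p : R -> R) : Prop :=
  forall xi : R -> R, hill_solution p xi -> bounded_on_R xi.

(* The Cauchy problem x'' + k x + k x^3 = 0, x(0) = delta, x'(0) = 0; for k > 0
   it has exactly one solution on R. *)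
Definition duffing_solution (k delta : R) (x : R -> R) : Prop :=
  twice_derivable x /\
  (forall t : R, Derive_n x 2 t + k * x t + k * x t ^ 3 = 0) /\
  x 0 = delta /\ Derive x 0 = 0.

Definition nonlinear_mode (m : nat) (delta : R) (Theta : R -> R) : Prop :=
  duffing_solution (INR m ^ 4) delta Theta.

Definition linearly_stable (m n : nat) (Theta_m : R -> R) : Prop :=
  trivial_solution_stable
    (fun t : R => INR n ^ 4 + INR m ^ 2 * INR n ^ 2 * Theta_m t ^ 2).

Definition Psi (delta omega : R) : R :=
  2 * sqrt (2 * omega) *
  RInt (fun theta : R =>
          sqrt ((omega + delta ^ 2 * sin theta ^ 2) /
                (2 + delta ^ 2 + delta ^ 2 * sin theta ^ 2)))
       0 (PI / 2).

(* Main.v *)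
(** Proof. Write p = omega + Theta^2. In the Pruefer variables xi = r sin phi,
    xi' = sqrt p r cos phi one has phi' = sqrt p + (p' / 4p) sin (2 phi). The energy integral
    gives Theta = delta cos alpha with an explicit positive alpha', so p has period tau given by
    alpha tau = PI, decreases and then increases over one period, and the integral of sqrt p
    over a period is Psi. Hence phi advances over a period by Psi up to an error of at most
    ln (max p / min p) / 2, and the hypothesis keeps this advance strictly between two
    consecutive multiples of PI. So no solution is an eigenvector of the monodromy, which is
    therefore elliptic. *)

Require Import Defs.
From Stdlib Require Import Reals.
From Coquelicot Require Import Coquelicot.
From Stdlib Require Import ZArith Lia Lra.
Open Scope R_scope.

(** * Calculus on the real line *)

(** [auto_derive] leaves terms [Derive f t] for abstract functions; their values are taken from the
    hypotheses at the same point. *)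
Ltac rewrite_derivatives :=
  repeat match goal with
    H : is_derive _ ?t ?l |- context [Derive ?f ?t] =>
      rewrite (is_derive_unique f t l H)
  end.

Lemma is_derive_eq (f : R -> R) (t l l' : R) : is_derive f t l -> l = l' -> is_derive f t l'.
Proof. now intros H <-. Qed.

Lemma is_derive_continuous (f : R -> R) (t l : R) : is_derive f t l -> continuous f t.
Proof. intro H. apply (ex_derive_continuous f t). now exists l. Qed.

Lemma derive_nonpos_le (f df : R -> R) (a b : R) :
  a <= b -> (forall t, is_derive f t (df t)) ->
  (forall t, a <= t <= b -> df t <= 0) -> f b <= f a.
Proof.
intros Hab Hf Hdf.
destruct (MVT_gen f a b df) as [c [Hc E]].
- intros; apply Hf.
- intros t _. apply continuity_pt_filterlim. exact (is_derive_continuous _ _ _ (Hf t)).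
- rewrite Rmin_left, Rmax_right in Hc by lra. specialize (Hdf c Hc). nra.
Qed.

Lemma derive_pos_lt (f df : R -> R) (a b : R) :
  a < b -> (forall t, is_derive f t (df t)) -> (forall t, 0 < df t) -> f a < f b.
Proof.
intros Hab Hf Hdf.
destruct (MVT_gen f a b df) as [c [Hc E]].
- intros; apply Hf.
- intros t _. apply continuity_pt_filterlim. exact (is_derive_continuous _ _ _ (Hf t)).
- specialize (Hdf c). nra.
Qed.

Lemma derive_zero_const (f : R -> R) (a b : R) :
  (forall t, is_derive f t 0) -> f a = f b.
Proof.
intros Hf.
destruct (MVT_gen f a b (fun _ => 0)) as [c [_ E]].
- intros; apply Hf.
- intros t _. apply continuity_pt_filterlim. exact (is_derive_continuous _ _ _ (Hf t)).
- lra.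
Qed.

Lemma antiderivative_exists (g : R -> R) :
  (forall t, continuous g t) ->
  exists G : R -> R, G 0 = 0 /\ forall t, is_derive G t (g t).
Proof.
intros Hg. exists (RInt g 0). split.
- exact (RInt_point 0 g).
- intro t. apply is_derive_RInt with 0; [|apply Hg].
  apply filter_forall. intro b. apply (@RInt_correct R_CompleteNormedModule).
  apply ex_RInt_continuous. intros; apply Hg.
Qed.

(** * Rotations of the plane and polar angles *)

(** Turning the vector (u, v) back by the accumulated angle [A] gives a vector with zero derivative;
    its two components are the constants [E1] and [E2]. *)
Lemma rotation_system (u v A g : R -> R) :
  (forall t, is_derive u t (g t * v t)) ->
  (forall t, is_derive v t (- g t * u t)) ->
  (forall t, is_derive A t (g t)) -> A 0 = 0 ->
  forall t, u t = u 0 * cos (A t) + v 0 * sin (A t) /\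
            v t = - u 0 * sin (A t) + v 0 * cos (A t).
Proof.
intros Hu Hv HA A0 t.
assert (E1 : u t * cos (A t) - v t * sin (A t) = u 0).
{ transitivity (u 0 * cos (A 0) - v 0 * sin (A 0)).
  - apply (derive_zero_const (fun t => u t * cos (A t) - v t * sin (A t))).
    intro s. specialize (Hu s). specialize (Hv s). specialize (HA s).
    auto_derive.
    + repeat split; eexists; eassumption.
    + rewrite_derivatives.
      ring.
  - rewrite A0, cos_0, sin_0. ring. }
assert (E2 : u t * sin (A t) + v t * cos (A t) = v 0).
{ transitivity (u 0 * sin (A 0) + v 0 * cos (A 0)).
  - apply (derive_zero_const (fun t => u t * sin (A t) + v t * cos (A t))).
    intro s. specialize (Hu s). specialize (Hv s). specialize (HA s).
    auto_derive.
    + repeat split; eexists; eassumption.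
    + rewrite_derivatives.
      ring.
  - rewrite A0, cos_0, sin_0. ring. }
pose proof (sin2_cos2 (A t)) as S. unfold Rsqr in S.
rewrite <- E1, <- E2. split.
- transitivity (u t * (sin (A t) * sin (A t) + cos (A t) * cos (A t))); [rewrite S|]; ring.
- transitivity (v t * (sin (A t) * sin (A t) + cos (A t) * cos (A t))); [rewrite S|]; ring.
Qed.

(** The normalised vector (y1, y2) / r obeys a rotation system with speed [g], so integrating [g]
    yields a continuous clockwise angle, counted from time 0, without any branch of the arctangent.
    The last clause is the cross product of the vectors at times 0 and t. *)
Lemma polar_angle (y1 y2 d1 d2 : R -> R) :
  (forall t, is_derive y1 t (d1 t)) -> (forall t, is_derive y2 t (d2 t)) ->
  (forall t, continuous d1 t) -> (forall t, continuous d2 t) ->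
  (forall t, 0 < y1 t ^ 2 + y2 t ^ 2) ->
  exists A : R -> R, A 0 = 0 /\
    (forall t, is_derive A t ((d1 t * y2 t - y1 t * d2 t) / (y1 t ^ 2 + y2 t ^ 2))) /\
    (forall t, y1 0 * y2 t - y2 0 * y1 t =
       - (sqrt (y1 0 ^ 2 + y2 0 ^ 2) * sqrt (y1 t ^ 2 + y2 t ^ 2) * sin (A t))).
Proof.
intros H1 H2 C1 C2 Hpos.
set (r := fun t => sqrt (y1 t ^ 2 + y2 t ^ 2)).
set (g := fun t => (d1 t * y2 t - y1 t * d2 t) / (y1 t ^ 2 + y2 t ^ 2)).
assert (Hr : forall t, 0 < r t) by (intro t; apply sqrt_lt_R0, Hpos).
assert (Hr2 : forall t, r t * r t = y1 t ^ 2 + y2 t ^ 2)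
  by (intro t; apply sqrt_sqrt; generalize (Hpos t); lra).
assert (Dr : forall t, is_derive r t ((y1 t * d1 t + y2 t * d2 t) / r t)).
{ intro t. unfold r at 1. specialize (H1 t). specialize (H2 t). specialize (Hpos t).
  specialize (Hr t).
  auto_derive.
  - repeat split; try (eexists; eassumption). simpl in Hpos. now rewrite !Rmult_1_r in *.
  - rewrite_derivatives.
    replace (sqrt _) with (r t) by (unfold r; f_equal; ring).
    field. lra. }
assert (Du : forall t, is_derive (fun t => y1 t / r t) t (g t * (y2 t / r t))).
{ intro t. eapply is_derive_eq.
  - apply is_derive_div; [apply H1 | apply Dr | generalize (Hr t); lra].
  - unfold g. rewrite <- Hr2. specialize (Hr t).
    transitivity ((d1 t * (r t * r t) - y1 t * (y1 t * d1 t + y2 t * d2 t)) / (r t * r t * r t));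
      [field; lra|].
    replace (d1 t * (r t * r t) - y1 t * (y1 t * d1 t + y2 t * d2 t))
      with ((d1 t * y2 t - y1 t * d2 t) * y2 t) by (rewrite Hr2; ring).
    field; lra. }
assert (Dv : forall t, is_derive (fun t => y2 t / r t) t (- g t * (y1 t / r t))).
{ intro t. eapply is_derive_eq.
  - apply is_derive_div; [apply H2 | apply Dr | generalize (Hr t); lra].
  - unfold g. rewrite <- Hr2. specialize (Hr t).
    transitivity ((d2 t * (r t * r t) - y2 t * (y1 t * d1 t + y2 t * d2 t)) / (r t * r t * r t));
      [field; lra|].
    replace (d2 t * (r t * r t) - y2 t * (y1 t * d1 t + y2 t * d2 t))
      with (- (d1 t * y2 t - y1 t * d2 t) * y1 t) by (rewrite Hr2; ring).
    field; lra. }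
assert (K1 : forall t, continuous y1 t) by (intro t; eapply is_derive_continuous, H1).
assert (K2 : forall t, continuous y2 t) by (intro t; eapply is_derive_continuous, H2).
destruct (antiderivative_exists g) as [A [A0 DA]].
{ intro t. unfold g, Rdiv. apply (continuous_mult (K := R_AbsRing)).
  - apply (continuous_minus (V := R_NormedModule));
      now apply (continuous_mult (K := R_AbsRing)).
  - apply continuous_Rinv_comp.
    + apply (is_derive_continuous _ t (2 * y1 t * d1 t + 2 * y2 t * d2 t)).
      specialize (H1 t). specialize (H2 t).
      auto_derive; [repeat split; eexists; eassumption|].
      rewrite_derivatives.
      ring.
    + generalize (Hpos t); lra. }
exists A. split; [exact A0|]. split; [exact DA|]. intro t.
destruct (rotation_system _ _ A g Du Dv DA A0 t) as [Eu Ev].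
fold (r t) (r 0).
generalize (Hr t) (Hr 0) (Hr2 0). intros Pt P0 Q0.
assert (Eu' : y1 t = r t * (y1 t / r t)) by (field; lra).
assert (Ev' : y2 t = r t * (y2 t / r t)) by (field; lra).
rewrite Ev', Eu', Eu, Ev.
transitivity (- (r t * ((y1 0 ^ 2 + y2 0 ^ 2) / r 0) * sin (A t))); [field; lra|].
rewrite <- Q0. field. lra.
Qed.

(** * Increment bounds and periodic functions *)

Lemma abs_diff_le_of_derive (D L d l : R -> R) (a b : R) :
  a <= b -> (forall t, is_derive D t (d t)) -> (forall t, is_derive L t (l t)) ->
  (forall t, a <= t <= b -> Rabs (d t) <= l t) ->
  Rabs (D b - D a) <= L b - L a.
Proof.
intros Hab HD HL Hdl.
assert (H1 : D b - L b <= D a - L a).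
{ apply (derive_nonpos_le (fun t => D t - L t) (fun t => d t - l t)); [exact Hab| |].
  - intro t. now apply (is_derive_minus (V := R_NormedModule)).
  - intros t Ht. generalize (Hdl t Ht) (Rle_abs (d t)). lra. }
assert (H2 : - D b - L b <= - D a - L a).
{ apply (derive_nonpos_le (fun t => - D t - L t) (fun t => - d t - l t)); [exact Hab| |].
  - intro t. apply (is_derive_minus (V := R_NormedModule)); [|apply HL].
    now apply (is_derive_opp (V := R_NormedModule)).
  - intros t Ht. generalize (Hdl t Ht) (Rle_abs (- d t)). rewrite Rabs_Ropp. lra. }
apply Rabs_le. lra.
Qed.

Lemma periodic_continuous_bounded (f : R -> R) (tau : R) :
  0 < tau -> (forall t, f (t + tau) = f t) -> (forall t, continuous f t) ->
  exists M, forall t, f t <= M.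
Proof.
intros Htau Hper Hcont.
assert (HN : forall (n : nat) t, f (t + INR n * tau) = f t).
{ induction n as [|n IH]; intro t.
  - simpl. f_equal. ring.
  - rewrite S_INR, <- (IH t), <- (Hper (t + INR n * tau)). f_equal. ring. }
assert (HZ : forall (z : Z) t, f (t + IZR z * tau) = f t).
{ intros z t. destruct (Z_le_dec 0 z) as [Hz|Hz].
  - rewrite <- (Z2Nat.id z) by assumption. rewrite <- INR_IZR_INZ. apply HN.
  - rewrite <- (HN (Z.to_nat (- z)) (t + IZR z * tau)).
    rewrite INR_IZR_INZ, Z2Nat.id, opp_IZR by lia. f_equal. ring. }
destruct (continuity_ab_maj f 0 tau) as [m [Hm _]]; [lra| |].
{ intros c _. apply continuity_pt_filterlim, Hcont. }
exists (f m). intro t.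
rewrite <- (HZ (- Int_part (t / tau))%Z t). apply Hm.
destruct (base_Int_part (t / tau)) as [B1 B2].
assert (Et : t = t / tau * tau) by (field; lra).
rewrite opp_IZR. split; nra.
Qed.

(** * Hill's equation as a plane system and its Pruefer angle *)

(** First-order form with [y] in the role of x'; naming the derivative makes shifts and linear
    combinations of solutions easy to form. *)
Definition hill_pair (p x y : R -> R) : Prop :=
  (forall t, is_derive x t (y t)) /\ (forall t, is_derive y t (- p t * x t)).

(** Gronwall's argument: E = x^2 + y^2 satisfies |E'| <= (1 + K) E, so E exp (c t) is nondecreasing
    and E exp (- c t) nonincreasing. The first serves for t >= 0, the second for t < 0. *)
Lemma hill_pair_nonzero (p x y : R -> R) (K : R) :
  (forall t, 0 <= p t <= K) -> hill_pair p x y -> 0 < x 0 ^ 2 + y 0 ^ 2 ->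
  forall t, 0 < x t ^ 2 + y t ^ 2.
Proof.
intros Hp [Hx Hy] H0 t.
set (E := fun t => x t ^ 2 + y t ^ 2). set (c := 1 + K).
assert (HE : forall s, Rabs (2 * x s * y s * (1 - p s)) <= c * E s).
{ intro s. unfold E, c. rewrite Rabs_mult.
  assert (A1 : Rabs (2 * x s * y s) <= x s ^ 2 + y s ^ 2)
    by (apply Rabs_le; generalize (pow2_ge_0 (x s + y s)) (pow2_ge_0 (x s - y s)); lra).
  assert (A2 : Rabs (1 - p s) <= 1 + K) by (apply Rabs_le; specialize (Hp s); lra).
  rewrite (Rmult_comm (1 + K)). apply Rmult_le_compat; auto using Rabs_pos. }
destruct (Rle_dec 0 t) as [Ht|Ht].
- assert (L : - (E t * exp (c * t)) <= - (E 0 * exp (c * 0))).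
  { apply (derive_nonpos_le (fun s => - (E s * exp (c * s)))
      (fun s => - ((2 * x s * y s * (1 - p s) + c * E s) * exp (c * s)))); [exact Ht| |].
    - intro s. specialize (Hx s). specialize (Hy s). unfold E.
      auto_derive; [repeat split; eexists; eassumption|].
      rewrite_derivatives. ring.
    - intros s _. generalize (HE s) (Rle_abs (- (2 * x s * y s * (1 - p s)))) (exp_pos (c * s)).
      rewrite Rabs_Ropp. nra. }
  rewrite Rmult_0_r, exp_0 in L. generalize (exp_pos (c * t)). fold (E t). fold (E 0) in H0. nra.
- assert (L : E 0 * exp (- c * 0) <= E t * exp (- c * t)).
  { apply (derive_nonpos_le (fun s => E s * exp (- c * s))
      (fun s => (2 * x s * y s * (1 - p s) - c * E s) * exp (- c * s))); [lra| |].
    - intro s. specialize (Hx s). specialize (Hy s). unfold E.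
      auto_derive; [repeat split; eexists; eassumption|].
      rewrite_derivatives. ring.
    - intros s _. generalize (HE s) (Rle_abs (2 * x s * y s * (1 - p s))) (exp_pos (- c * s)). nra. }
  rewrite Rmult_0_r, exp_0 in L. generalize (exp_pos (- c * t)). fold (E t). fold (E 0) in H0. nra.
Qed.

(** [A] is the angle turned by the vector (x, y / sqrt p). The last clause links it to the
    monodromy: the determinant is zero exactly when the vectors (x, y) at times 0 and [tau] are
    parallel. *)
Lemma prufer_angle (p dp x y : R -> R) (tau : R) :
  (forall t, 0 < p t) -> (forall t, is_derive p t (dp t)) -> (forall t, continuous dp t) ->
  hill_pair p x y -> (forall t, 0 < x t ^ 2 + y t ^ 2) -> p tau = p 0 ->
  exists A dA : R -> R, A 0 = 0 /\ (forall t, is_derive A t (dA t)) /\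
    (forall t, Rabs (dA t - sqrt (p t)) <= Rabs (dp t) / (4 * p t)) /\
    (sin (A tau) <> 0 -> x 0 * y tau - y 0 * x tau <> 0).
Proof.
intros Hp Dp Cdp [Hx Hy] Hpos Hper.
set (q := fun t => sqrt (p t)).
assert (Hq : forall t, 0 < q t) by (intro t; apply sqrt_lt_R0, Hp).
assert (Hq2 : forall t, q t * q t = p t) by (intro t; apply sqrt_sqrt; generalize (Hp t); lra).
assert (Dq : forall t, is_derive q t (dp t / (2 * q t))).
{ intro t. unfold q at 1. specialize (Dp t). specialize (Hp t). specialize (Hq t).
  auto_derive; [split; [eexists; eassumption | split; [assumption|exact I]]|].
  rewrite_derivatives. fold (q t). field. lra. }
assert (D2 : forall t, is_derive (fun t => y t / q t) t
               (- q t * x t - dp t / (2 * p t) * (y t / q t))).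
{ intro t. eapply is_derive_eq.
  - apply is_derive_div; [apply Hy | apply Dq | generalize (Hq t); lra].
  - rewrite <- Hq2. field. generalize (Hq t); lra. }
assert (Cx : forall t, continuous x t) by (intro t; eapply is_derive_continuous, Hx).
assert (Cy : forall t, continuous y t) by (intro t; eapply is_derive_continuous, Hy).
assert (Cq : forall t, continuous q t) by (intro t; eapply is_derive_continuous, Dq).
assert (Cp : forall t, continuous p t) by (intro t; eapply is_derive_continuous, Dp).
assert (C2 : forall t, continuous (fun t => y t / q t) t)
  by (intro t; eapply is_derive_continuous, D2).
assert (R2 : forall t, 0 < x t ^ 2 + (y t / q t) ^ 2).
{ intro t. specialize (Hpos t). specialize (Hq t).
  destruct (Req_dec (y t) 0) as [Ey|Ey].
  - rewrite Ey in *. replace ((0 / q t) ^ 2) with 0 by (field; lra). nra.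
  - assert (y t / q t <> 0)
      by (apply Rmult_integral_contrapositive_currified; [exact Ey|apply Rinv_neq_0_compat; lra]).
    nra. }
destruct (polar_angle x (fun t => y t / q t) y
            (fun t => - q t * x t - dp t / (2 * p t) * (y t / q t))) as [A [A0 [DA SA]]].
- exact Hx.
- exact D2.
- exact Cy.
- intro t. apply (continuous_minus (V := R_NormedModule)).
  + apply (continuous_mult (K := R_AbsRing)); [|apply Cx].
    now apply (continuous_opp (V := R_NormedModule)).
  + apply (continuous_mult (K := R_AbsRing)); [|apply C2].
    apply (continuous_mult (K := R_AbsRing)); [apply Cdp|].
    apply continuous_Rinv_comp; [|generalize (Hp t); lra].
    apply (continuous_mult (K := R_AbsRing)); [apply continuous_const|apply Cp].
- exact R2.
- eexists. eexists. split; [exact A0|]. split; [exact DA|]. split.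
  + intro t. specialize (R2 t). specialize (Hq t). specialize (Hp t). specialize (Hq2 t).
    fold (q t). cbv beta.
    set (v := y t / q t) in *.
    assert (Ev : y t = q t * v) by (unfold v; field; lra).
    rewrite Ev.
    (* The second factor is sin (2 phi) for x = r sin phi, v = r cos phi, hence at most 1 in
       absolute value. *)
    replace (_ - q t) with ((dp t / (4 * p t)) * (2 * x t * v / (x t ^ 2 + v ^ 2)))
      by (field; lra).
    rewrite Rabs_mult.
    assert (B : Rabs (2 * x t * v / (x t ^ 2 + v ^ 2)) <= 1).
    { unfold Rdiv. rewrite Rabs_mult, (Rabs_pos_eq (/ _)) by (left; now apply Rinv_0_lt_compat).
      apply Rmult_le_reg_r with (x t ^ 2 + v ^ 2); [assumption|].
      rewrite Rmult_assoc, Rinv_l by lra. rewrite Rmult_1_r, Rmult_1_l.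
      apply Rabs_le. generalize (pow2_ge_0 (x t + v)) (pow2_ge_0 (x t - v)). lra. }
    unfold Rdiv at 1. rewrite Rabs_mult, (Rabs_pos_eq (/ _)) by (left; apply Rinv_0_lt_compat; lra).
    assert (0 <= Rabs (dp t) / (4 * p t)) by (apply Rle_mult_inv_pos; [apply Rabs_pos|lra]).
    nra.
  + intros HS HW. specialize (SA tau). cbv beta in SA.
    (* Equal weights at both ends make the cross product in Pruefer coordinates a multiple of the
       one in (x, y). *)
    assert (Eq : q tau = q 0) by (unfold q; now rewrite Hper).
    generalize (Hq 0). intro Q0.
    assert (Z : x 0 * (y tau / q tau) - y 0 / q 0 * x tau = 0).
    { rewrite Eq. replace (_ - _) with ((x 0 * y tau - y 0 * x tau) / q 0) by (field; lra).
      rewrite HW. field; lra. }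
    rewrite Z in SA.
    generalize (sqrt_lt_R0 _ (R2 0)) (sqrt_lt_R0 _ (R2 tau)). intros S1 S2.
    symmetry in SA. apply Ropp_eq_0_compat in SA. rewrite Ropp_involutive in SA.
    apply Rmult_integral in SA. destruct SA as [SA|SA]; [|now apply HS].
    generalize (Rmult_lt_0_compat _ _ S1 S2). rewrite SA. lra.
Qed.

(** * Monodromy and boundedness *)

Lemma wronskian_const (p x1 y1 x2 y2 : R -> R) (a b : R) :
  hill_pair p x1 y1 -> hill_pair p x2 y2 ->
  x1 a * y2 a - y1 a * x2 a = x1 b * y2 b - y1 b * x2 b.
Proof.
intros [Hx1 Hy1] [Hx2 Hy2].
apply (derive_zero_const (fun t => x1 t * y2 t - y1 t * x2 t)). intro t.
specialize (Hx1 t). specialize (Hy1 t). specialize (Hx2 t). specialize (Hy2 t).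
auto_derive; [repeat split; eexists; eassumption|].
rewrite_derivatives. ring.
Qed.

Lemma hill_pair_shift (p x y : R -> R) (tau : R) :
  (forall t, p (t + tau) = p t) -> hill_pair p x y ->
  hill_pair p (fun t => x (t + tau)) (fun t => y (t + tau)).
Proof.
intros Hper [Hx Hy]. split; intro t.
- specialize (Hx (t + tau)).
  auto_derive; [eexists; eassumption|]. rewrite_derivatives. ring.
- specialize (Hy (t + tau)).
  auto_derive; [eexists; eassumption|]. rewrite_derivatives. rewrite Hper. ring.
Qed.

Lemma hill_pair_comb (p x1 y1 x2 y2 : R -> R) (c : R) :
  hill_pair p x1 y1 -> hill_pair p x2 y2 ->
  hill_pair p (fun t => x1 t - c * x2 t) (fun t => y1 t - c * y2 t).
Proof.
intros [Hx1 Hy1] [Hx2 Hy2].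
split; intro t; specialize (Hx1 t); specialize (Hy1 t); specialize (Hx2 t); specialize (Hy2 t);
  auto_derive; try (repeat split; eexists; eassumption); rewrite_derivatives; ring.
Qed.

(** The turning hypothesis says that no nonzero initial vector is an eigenvector of the monodromy
    matrix. That matrix has determinant 1, so its trace [a] satisfies |a| < 2. *)
Lemma no_multiplier_bounded (p : R -> R) (tau : R) :
  0 < tau -> (forall t, p (t + tau) = p t) ->
  (forall x y, hill_pair p x y -> 0 < x 0 ^ 2 + y 0 ^ 2 -> x 0 * y tau - y 0 * x tau <> 0) ->
  forall x y, hill_pair p x y -> 0 < x 0 ^ 2 + y 0 ^ 2 -> bounded_on_R x.
Proof.
intros Htau Hper Hturn x y Hxy H0.
pose proof (hill_pair_shift p x y tau Hper Hxy) as Hxy2.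
pose proof (hill_pair_shift _ _ _ tau Hper Hxy2) as Hxy3.
set (w := x 0 * y tau - y 0 * x tau).
assert (Hw : w <> 0) by (now apply Hturn).
(* The trace of the monodromy, read off from Cayley-Hamilton, M^2 v = a M v - v, by taking the
   determinant with v. *)
set (a := (x 0 * y (tau + tau) - y 0 * x (tau + tau)) / w).
assert (W12 : forall t, x t * y (t + tau) - y t * x (t + tau) = w).
{ intro t. rewrite (wronskian_const p x y _ _ t 0 Hxy Hxy2). unfold w. now rewrite Rplus_0_l. }
assert (W13 : forall t, x t * y (t + tau + tau) - y t * x (t + tau + tau) = a * w).
{ intro t. rewrite (wronskian_const p x y _ _ t 0 Hxy Hxy3). unfold a.
  rewrite Rplus_0_l. field. exact Hw. }
(* Linear relation among three plane vectors, the values of (x, y) at t, t + tau and t + 2 tau: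
   consecutive ones have determinant [w], the outer two [a * w]. *)
assert (Rx : forall t, x (t + tau + tau) = a * x (t + tau) - x t).
{ intro t. apply Rmult_eq_reg_l with w; [|exact Hw].
  generalize (W12 t) (W12 (t + tau)) (W13 t). intros E1 E2 E3.
  transitivity (x (t + tau) * (a * w) - x t * w); [|ring].
  rewrite <- E3. rewrite <- E2 at 2. rewrite <- E1. ring. }
assert (Ry : forall t, y (t + tau + tau) = a * y (t + tau) - y t).
{ intro t. apply Rmult_eq_reg_l with w; [|exact Hw].
  generalize (W12 t) (W12 (t + tau)) (W13 t). intros E1 E2 E3.
  transitivity (y (t + tau) * (a * w) - y t * w); [|ring].
  rewrite <- E3. rewrite <- E2 at 2. rewrite <- E1. ring. }
assert (Ha : a ^ 2 < 4).
{ apply Rnot_le_lt. intro Hge.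
  (* A root l of l^2 - a l + 1 would be a real multiplier, with eigenvector x(.+tau) - (a-l) x. *)
  assert (Hl : exists l, l * (a - l) = 1).
  { exists ((a + sqrt (a ^ 2 - 4)) / 2).
    assert (S : sqrt (a ^ 2 - 4) * sqrt (a ^ 2 - 4) = a ^ 2 - 4) by (apply sqrt_sqrt; lra).
    nra. }
  destruct Hl as [l Hl].
  pose proof (hill_pair_comb _ _ _ _ _ (a - l) Hxy2 Hxy) as Hz.
  apply (Hturn _ _ Hz).
  - rewrite !Rplus_0_l.
    set (z1 := x tau - _). set (z2 := y tau - _).
    assert (Ez : x 0 * z2 - y 0 * z1 = w) by (unfold z1, z2, w; ring).
    destruct (Req_dec z1 0) as [E1|E1]; [destruct (Req_dec z2 0) as [E2|E2]|]; [|nra|nra].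
    rewrite E1, E2 in Ez. exfalso. apply Hw. rewrite <- Ez. ring.
  - generalize (Rx 0) (Ry 0). rewrite !Rplus_0_l. intros -> ->.
    replace (a * y tau - y 0 - (a - l) * y tau) with (l * y tau - l * (a - l) * y 0)
      by (rewrite Hl; ring).
    replace (a * x tau - x 0 - (a - l) * x tau) with (l * x tau - l * (a - l) * x 0)
      by (rewrite Hl; ring).
    ring. }
(* The monodromy is elliptic, so it preserves a definite quadratic form. *)
set (Q := fun t => x t ^ 2 - a * x t * x (t + tau) + x (t + tau) ^ 2).
destruct (periodic_continuous_bounded Q tau Htau) as [M HM].
- intro t. unfold Q. rewrite Rx. ring.
- intro t. destruct Hxy as [Hx _]. destruct Hxy2 as [Hx2 _].
  specialize (Hx t). specialize (Hx2 t).
  apply (ex_derive_continuous Q). unfold Q.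
  apply (ex_derive_plus (V := R_NormedModule)); [apply (ex_derive_minus (V := R_NormedModule))|].
  + apply ex_derive_pow. eexists; eassumption.
  + apply ex_derive_mult; [apply ex_derive_mult|]; try (eexists; eassumption).
    apply ex_derive_const.
  + apply (ex_derive_pow (fun t => x (t + tau))). eexists; eassumption.
(* Completing the square gives Q = (x (t + tau) - a / 2 x)^2 + (1 - a^2 / 4) x^2, hence x^2 <= M /
   (1 - a^2 / 4). *)
- exists (sqrt (M / (1 - a ^ 2 / 4))). intro t.
  rewrite <- sqrt_Rsqr_abs. apply sqrt_le_1_alt. unfold Rsqr.
  apply Rmult_le_reg_r with (1 - a ^ 2 / 4); [lra|].
  replace (M / _ * _) with M by (field; lra).
  apply Rle_trans with (Q t); [|apply HM].
  unfold Q. generalize (pow2_ge_0 (x (t + tau) - a / 2 * x t)). nra.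
Qed.

(** * A stability criterion for periodic Hill equations *)

(** On each monotone piece |p'| / (4 p) integrates to ln (p 0 / p tau1) / 4. Hence the Pruefer angle
    over a period differs from the increment of [P] by at most half of that logarithm and lies
    strictly between l PI and (l + 1) PI, where the sine has no zero. *)
Lemma hill_angle_criterion (p dp P : R -> R) (K tau1 tau : R) (l : nat) :
  (forall t, 0 < p t <= K) -> (forall t, is_derive p t (dp t)) -> (forall t, continuous dp t) ->
  0 < tau1 < tau -> (forall t, p (t + tau) = p t) ->
  (forall t, 0 <= t <= tau1 -> dp t <= 0) -> (forall t, tau1 <= t <= tau -> 0 <= dp t) ->
  (forall t, is_derive P t (sqrt (p t))) ->
  ln (p 0 / p tau1) < 2 * Rmin (P tau - P 0 - INR l * PI) ((INR l + 1) * PI - (P tau - P 0)) ->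
  trivial_solution_stable p.
Proof.
intros Hp Dp Cdp Htau Hper Hdec Hinc DP Hln xi [Hxi1 Hxi2].
assert (Hpair : hill_pair p xi (Derive xi)).
{ split; intro t.
  - apply Derive_correct, Hxi1.
  - destruct (Hxi1 t) as [_ H]. apply Derive_correct in H. eapply is_derive_eq; [exact H|].
    specialize (Hxi2 t). change (Derive_n xi 2 t) with (Derive (Derive xi) t) in Hxi2. lra. }
assert (Hp0 : forall t, 0 < p t) by apply Hp.
assert (HpK : forall t, 0 <= p t <= K) by (intro t; specialize (Hp t); lra).
assert (Hptau : p tau = p 0) by (rewrite <- (Hper 0); f_equal; ring).
destruct (Rle_lt_or_eq_dec 0 (xi 0 ^ 2 + Derive xi 0 ^ 2)) as [H0|H0]; [nra| |].
- apply (no_multiplier_bounded p tau) with (y := Derive xi); try assumption; [lra|].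
  intros x y Hxy Hxy0.
  pose proof (hill_pair_nonzero p x y K HpK Hxy Hxy0) as Hpos.
  destruct (prufer_angle p dp x y tau Hp0 Dp Cdp Hxy Hpos Hptau) as [A [dA [A0 [DA [BA SA]]]]].
  apply SA.
  set (D := fun t => A t - P t).
  assert (DD : forall t, is_derive D t (dA t - sqrt (p t)))
    by (intro t; now apply (is_derive_minus (V := R_NormedModule))).
  assert (DL : forall c t, is_derive (fun t => c * ln (p t)) t (c * (dp t / p t))).
  { intros c t. specialize (Dp t). auto_derive.
    - repeat split; [eexists; eassumption|apply Hp0].
    - rewrite_derivatives. field. generalize (Hp0 t); lra. }
  assert (B1 : Rabs (D tau1 - D 0) <= - / 4 * ln (p tau1) - - / 4 * ln (p 0)).
  { apply (abs_diff_le_of_derive D _ _ _ 0 tau1 ltac:(lra) DD (DL (- / 4))).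
    intros t Ht. eapply Rle_trans; [apply BA|]. rewrite Rabs_left1 by now apply Hdec.
    apply Req_le. field. generalize (Hp0 t); lra. }
  assert (B2 : Rabs (D tau - D tau1) <= / 4 * ln (p tau) - / 4 * ln (p tau1)).
  { apply (abs_diff_le_of_derive D _ _ _ tau1 tau ltac:(lra) DD (DL (/ 4))).
    intros t Ht. eapply Rle_trans; [apply BA|]. rewrite Rabs_pos_eq by now apply Hinc.
    apply Req_le. field. generalize (Hp0 t); lra. }
  rewrite Hptau in B2. rewrite ln_div in Hln by apply Hp0.
  apply Rabs_le_between in B1. apply Rabs_le_between in B2.
  unfold D in B1, B2. rewrite A0 in B1.
  generalize (Rmin_l (P tau - P 0 - INR l * PI) ((INR l + 1) * PI - (P tau - P 0)))
    (Rmin_r (P tau - P 0 - INR l * PI) ((INR l + 1) * PI - (P tau - P 0))). intros M1 M2.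
  assert (I1 : INR l * PI < A tau) by lra.
  assert (I2 : A tau < (INR l + 1) * PI) by lra.
  intro Z. apply sin_eq_0_0 in Z. destruct Z as [k Hk]. rewrite Hk in I1, I2.
  apply Rmult_lt_reg_r in I1; [|apply PI_RGT_0]. apply Rmult_lt_reg_r in I2; [|apply PI_RGT_0].
  rewrite INR_IZR_INZ in I1, I2. change 1 with (IZR 1) in I2. rewrite <- plus_IZR in I2.
  apply lt_IZR in I1. apply lt_IZR in I2. lia.
(* Zero initial data: if xi t were nonzero, the solution restarted at time t would stay nonzero, in
   particular at time - t, which is the original origin. *)
- exists 0. intro t. right. rewrite <- Rabs_R0. f_equal.
  destruct (Req_dec (xi t) 0) as [E|E]; [exact E|exfalso].
  pose proof (hill_pair_nonzero (fun s => p (s + t)) (fun s => xi (s + t))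
    (fun s => Derive xi (s + t)) K) as N.
  enough (C : 0 < xi (- t + t) ^ 2 + Derive xi (- t + t) ^ 2).
  { replace (- t + t) with 0 in C by ring. lra. }
  apply N.
  + intro s. apply HpK.
  + destruct Hpair as [Hx Hy]. split; intro s.
    * specialize (Hx (s + t)). auto_derive; [eexists; eassumption|]. rewrite_derivatives. ring.
    * specialize (Hy (s + t)). auto_derive; [eexists; eassumption|]. rewrite_derivatives. ring.
  + rewrite Rplus_0_l. nra.
Qed.

(** * Motion of an autonomous phase *)

(* The time T s needed to reach the phase s is the integral of 1 / h; it inverts the phase and
   inherits its quasi-periodicity from the periodicity of h. *)
Lemma autonomous_phase (h al : R -> R) (L : R) :
  (forall s, continuous h s) -> (forall s, 0 < h s) -> (forall s, h (s + L) = h s) ->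
  (forall t, is_derive al t (h (al t))) -> al 0 = 0 ->
  exists T : R -> R, T 0 = 0 /\ (forall a b, a < b -> T a < T b) /\
    (forall t, T (al t) = t) /\ (forall s, al (T s) = s) /\
    (forall t, al (t + T L) = al t + L).
Proof.
intros Ch Hh Per Dal al0.
destruct (antiderivative_exists (fun s => / h s)) as [T [T0 DT]].
{ intro s. apply continuous_Rinv_comp; [apply Ch | generalize (Hh s); lra]. }
assert (Tinc : forall a b, a < b -> T a < T b).
{ intros a b Hab. apply (derive_pos_lt T (fun s => / h s)); auto.
  intro s. apply Rinv_0_lt_compat, Hh. }
assert (Tinj : forall a b, T a = T b -> a = b).
{ intros a b E. destruct (Rtotal_order a b) as [H|[H|H]]; [|exact H|];
    apply Tinc in H; lra. }
assert (Tal : forall t, T (al t) = t).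
{ intro t. apply Rminus_diag_uniq.
  transitivity (T (al 0) - 0); [|rewrite al0, T0; ring].
  apply (derive_zero_const (fun t => T (al t) - t)). intro s. eapply is_derive_eq.
  - apply (is_derive_minus (V := R_NormedModule)); [|apply (is_derive_id (K := R_AbsRing))].
    apply (is_derive_comp (V := R_NormedModule) T al); [apply DT | apply Dal].
  - unfold minus, plus, opp, scal, one; simpl; unfold mult; simpl.
    field. generalize (Hh (al s)); lra. }
assert (Tper : forall s, T (s + L) = T s + T L).
{ intro s. apply Rplus_eq_reg_r with (- T s).
  transitivity (T (0 + L) - T 0); [|rewrite Rplus_0_l, T0; ring].
  apply (derive_zero_const (fun s => T (s + L) - T s)). intro r. eapply is_derive_eq.
  - apply (is_derive_minus (V := R_NormedModule)); [|apply DT].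
    apply (is_derive_comp (V := R_NormedModule) T (fun s => s + L)); [apply DT|].
    apply (is_derive_plus (V := R_NormedModule));
      [apply (is_derive_id (K := R_AbsRing)) | apply (is_derive_const (V := R_NormedModule))].
  - rewrite Per. unfold minus, plus, opp, scal, one, zero; simpl; unfold mult; simpl. ring. }
(* [T] is injective, so from T (al (T s)) = T s its left inverse property gives al (T s) = s. *)
exists T. repeat split; auto.
intro t. apply Tinj. now rewrite Tal, Tper, Tal.
Qed.

(** * The phase of the Duffing oscillator *)

(** The radicand is the cofactor of delta^2 - x^2 in the energy integral solved for x'^2. *)
Definition phase_speed (k delta x : R) : R := sqrt (k / 2 * (2 + delta ^ 2 + x ^ 2)).

Lemma phase_speed_radicand_pos (k delta x : R) :
  0 < k -> 0 < k / 2 * (2 + delta ^ 2 + x ^ 2).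
Proof.
intro Hk. generalize (pow2_ge_0 delta) (pow2_ge_0 x). intros.
apply Rmult_lt_0_compat; lra.
Qed.

Lemma phase_speed_pos (k delta x : R) : 0 < k -> 0 < phase_speed k delta x.
Proof. intro Hk. now apply sqrt_lt_R0, phase_speed_radicand_pos. Qed.

Lemma phase_speed_comp_continuous (k delta : R) (x : R -> R) (t : R) :
  0 < k -> ex_derive x t -> continuous (fun t => phase_speed k delta (x t)) t.
Proof.
intros Hk Hx. apply (ex_derive_continuous (fun t => phase_speed k delta (x t))).
unfold phase_speed. auto_derive. split; [exact Hx|]. split; [|exact I].
generalize (phase_speed_radicand_pos k delta (x t) Hk). simpl. now rewrite !Rmult_1_r.
Qed.

(* The energy integral reads x'^2 = q^2 (delta^2 - x^2) with q the phase speed; hence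
   (x, x' / q) rotates with angular velocity q. *)
Lemma duffing_phase (k delta : R) (x : R -> R) :
  0 < k -> duffing_solution k delta x ->
  exists al : R -> R, al 0 = 0 /\
    (forall t, is_derive al t (phase_speed k delta (x t))) /\
    (forall t, x t = delta * cos (al t)) /\
    (forall t, Derive x t = - delta * sin (al t) * phase_speed k delta (x t)).
Proof.
intros Hk [Hd [Heq [X0 Y0]]].
set (y := Derive x). set (q := fun t => phase_speed k delta (x t)).
assert (Hx : forall t, is_derive x t (y t)) by (intro t; apply Derive_correct, Hd).
assert (Hy : forall t, is_derive y t (- k * x t - k * x t ^ 3)).
{ intro t. destruct (Hd t) as [_ H]. apply Derive_correct in H. eapply is_derive_eq; [exact H|].
  specialize (Heq t). change (Derive_n x 2 t) with (Derive (Derive x) t) in Heq. lra. }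
assert (Hq : forall t, 0 < q t) by (intro t; now apply phase_speed_pos).
assert (Hq2 : forall t, q t * q t = k / 2 * (2 + delta ^ 2 + x t ^ 2)).
{ intro t. apply sqrt_sqrt. left. now apply phase_speed_radicand_pos. }
assert (Dq : forall t, is_derive q t (k * x t * y t / (2 * q t))).
{ intro t. unfold q at 1. unfold phase_speed.
  specialize (Hx t). specialize (Hq t).
  generalize (phase_speed_radicand_pos k delta (x t) Hk). intro Hr.
  auto_derive.
  - split; [eexists; eassumption|]. split; [|exact I]. simpl in Hr. now rewrite !Rmult_1_r in *.
  - rewrite_derivatives. replace (sqrt _) with (q t); [field; lra|].
    reflexivity. }
assert (En : forall t, y t ^ 2 = q t * q t * (delta ^ 2 - x t ^ 2)).
{ intro t. rewrite Hq2.
  enough (E : y t ^ 2 + k * x t ^ 2 + k / 2 * x t ^ 4 = k * delta ^ 2 + k / 2 * delta ^ 4) by lra.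
  transitivity (y 0 ^ 2 + k * x 0 ^ 2 + k / 2 * x 0 ^ 4); [|unfold y; rewrite X0, Y0; ring].
  apply (derive_zero_const (fun t => y t ^ 2 + k * x t ^ 2 + k / 2 * x t ^ 4)).
  intro s. specialize (Hx s). specialize (Hy s).
  auto_derive; [repeat split; eexists; eassumption|]. rewrite_derivatives. field. }
destruct (antiderivative_exists q) as [al [al0 Dal]].
{ intro t. eapply is_derive_continuous, Dq. }
assert (Du : forall t, is_derive x t (q t * (y t / q t))).
{ intro t. eapply is_derive_eq; [apply Hx|]. field. generalize (Hq t); lra. }
assert (Dv : forall t, is_derive (fun t => y t / q t) t (- q t * x t)).
{ intro t. eapply is_derive_eq.
  - apply is_derive_div; [apply Hy | apply Dq | generalize (Hq t); lra].
  - specialize (Hq t).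
    transitivity ((- k * x t * (1 + x t ^ 2) * (q t * q t) - k * x t / 2 * y t ^ 2) / (q t * q t * q t));
      [field; lra|].
    (* With y^2 eliminated, 1 + x^2 + (delta^2 - x^2) / 2 is half of 2 + delta^2 + x^2, so q^2
       reappears. *)
    rewrite En.
    transitivity (- x t * (k / 2 * (2 + delta ^ 2 + x t ^ 2)) / q t); [field; lra|].
    rewrite <- Hq2. field. lra. }
pose proof (rotation_system x (fun t => y t / q t) al q Du Dv Dal al0) as Rot.
cbv beta in Rot.
assert (V0 : y 0 / q 0 = 0) by (unfold y; rewrite Y0; field; generalize (Hq 0); lra).
rewrite V0, X0 in Rot.
exists al. split; [exact al0|]. split; [exact Dal|]. split; intro t; destruct (Rot t) as [R1 R2].
- rewrite R1. ring.
- fold (y t) (q t). replace (y t) with (y t / q t * q t) by (field; generalize (Hq t); lra).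
  rewrite R2. ring.
Qed.

(** * The integral [Psi] and stability in the normalised equation *)

(** The derivative of [F] is sqrt p divided by the phase speed, that is, sqrt p dt in the phase
    variable. It is symmetric about PI / 2, which turns the range from 0 to PI into twice a quarter
    turn, with sine for cosine. *)
Lemma Psi_antiderivative (delta omega : R) :
  0 < omega -> exists F : R -> R,
    (forall s, is_derive F s (sqrt (2 * omega) *
       sqrt ((omega + delta ^ 2 * cos s ^ 2) / (2 + delta ^ 2 + delta ^ 2 * cos s ^ 2)))) /\
    F PI - F 0 = Psi delta omega.
Proof.
intro Homega.
set (rho := fun z => (omega + delta ^ 2 * z ^ 2) / (2 + delta ^ 2 + delta ^ 2 * z ^ 2)).
assert (Rc : forall (c : R -> R) s, ex_derive c s -> continuous (fun s => sqrt (rho (c s))) s).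
{ intros c s Hc. apply (ex_derive_continuous (fun s => sqrt (rho (c s)))). unfold rho.
  assert (N : 0 < omega + delta ^ 2 * c s ^ 2) by (generalize (pow2_ge_0 delta) (pow2_ge_0 (c s)); nra).
  assert (D : 0 < 2 + delta ^ 2 + delta ^ 2 * c s ^ 2)
    by (generalize (pow2_ge_0 delta) (pow2_ge_0 (c s)); nra).
  generalize (Rdiv_lt_0_compat _ _ N D). intro Q.
  auto_derive. simpl in *. rewrite !Rmult_1_r in *. repeat split; try exact Hc; [lra|exact Q]. }
destruct (antiderivative_exists (fun s => sqrt (2 * omega) * sqrt (rho (cos s)))) as [F [F0 DF]].
{ intro s. apply (continuous_mult (K := R_AbsRing)); [apply continuous_const|].
  apply Rc. auto_derive. exact I. }
destruct (antiderivative_exists (fun s => sqrt (rho (sin s)))) as [G [G0 DG]].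
{ intro s. apply Rc. auto_derive. exact I. }
exists F. split; [exact DF|].
assert (HG : RInt (fun s => sqrt (rho (sin s))) 0 (PI / 2) = G (PI / 2)).
{ apply is_RInt_unique. replace (G (PI / 2)) with (minus (G (PI / 2)) (G 0))
    by (unfold minus, plus, opp; simpl; rewrite G0; ring).
  apply (is_RInt_derive (V := R_CompleteNormedModule) G (fun s => sqrt (rho (sin s)))).
  - intros; apply DG.
  - intros; apply Rc. auto_derive. exact I. }
unfold Psi. fold rho. change (fun theta : R => _) with (fun s => sqrt (rho (sin s))).
rewrite HG.
(* Replacing the half-width PI / 2 by a variable s gives a function of s with zero derivative that
   vanishes at s = 0. *)
enough (E : F (PI / 2 + PI / 2) - F (PI / 2 - PI / 2) - 2 * sqrt (2 * omega) * G (PI / 2) = 0).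
{ replace (PI / 2 + PI / 2) with PI in E by field.
  replace (PI / 2 - PI / 2) with 0 in E by field. lra. }
transitivity (F (PI / 2 + 0) - F (PI / 2 - 0) - 2 * sqrt (2 * omega) * G 0);
  [|rewrite G0, Rplus_0_r, Rminus_0_r; ring].
apply (derive_zero_const (fun s => F (PI / 2 + s) - F (PI / 2 - s) - 2 * sqrt (2 * omega) * G s)).
intro s.
generalize (DF (PI / 2 + s)) (DF (PI / 2 - s)) (DG s). intros D1 D2 D3.
auto_derive; [repeat split; eexists; eassumption|].
replace (PI / 2 + - s) with (PI / 2 - s) by ring.
rewrite_derivatives.
rewrite cos_shift, <- (Ropp_involutive (cos (PI / 2 + s))), <- sin_cos.
replace (rho (- sin s)) with (rho (sin s)) by (unfold rho; f_equal; ring).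
ring.
Qed.

Lemma duffing_hill_stable (delta omega : R) (x : R -> R) (l : nat) :
  0 < delta -> 0 < omega ->
  ln (1 + delta ^ 2 / omega) <
    2 * Rmin (Psi delta omega - INR l * PI) ((INR l + 1) * PI - Psi delta omega) ->
  duffing_solution (1 / omega) delta x ->
  trivial_solution_stable (fun t => omega + x t ^ 2).
Proof.
intros Hdelta Homega Hln Hx.
assert (Hk : 0 < 1 / omega) by (apply Rdiv_lt_0_compat; lra).
destruct (duffing_phase _ _ _ Hk Hx) as [al [al0 [Dal [Xal Yal]]]].
destruct Hx as [Hd [Heq _]].
set (h := fun s => phase_speed (1 / omega) delta (delta * cos s)).
assert (Dal' : forall t, is_derive al t (h (al t))).
{ intro t. eapply is_derive_eq; [apply Dal|]. unfold h. now rewrite <- Xal. }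
assert (Hh : forall s, 0 < h s) by (intro s; now apply phase_speed_pos).
destruct (autonomous_phase h al PI) as [T [T0 [Tinc [Tal [alT alper]]]]]; try assumption.
{ intro s. apply phase_speed_comp_continuous; [exact Hk|]. auto_derive. exact I. }
{ intro s. unfold h, phase_speed. rewrite neg_cos. f_equal. ring. }
assert (alle : forall t c, t <= T c -> al t <= c).
{ intros t c Ht. apply Rnot_lt_le. intro H. apply Tinc in H. rewrite Tal in H. lra. }
assert (alge : forall t c, T c <= t -> c <= al t).
{ intros t c Ht. apply Rnot_lt_le. intro H. apply Tinc in H. rewrite Tal in H. lra. }
destruct (Psi_antiderivative delta omega Homega) as [F [DF HF]].
assert (Hx' : forall t, is_derive x t (Derive x t)) by (intro t; apply Derive_correct, Hd).
generalize PI_RGT_0. intro HPI.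
(* In the phase, p = omega + delta^2 cos^2: maximal at phase 0, minimal at PI / 2, and PI-periodic
   because only the square of x enters. [T] converts these phases into times. *)
apply (hill_angle_criterion (fun t => omega + x t ^ 2) (fun t => 2 * x t * Derive x t)
         (fun t => F (al t)) (omega + delta ^ 2) (T (PI / 2)) (T PI) l).
- intro t. rewrite Xal. generalize (COS_bound (al t)). intros [C1 C2]. split.
  + generalize (pow2_ge_0 (delta * cos (al t))). lra.
  + assert (cos (al t) ^ 2 <= 1) by nra. generalize (pow2_ge_0 delta). nra.
- intro t. specialize (Hx' t). auto_derive; [eexists; eassumption|].
  rewrite_derivatives. ring.
- intro t. destruct (Hd t) as [Hd1 Hd2].
  apply (continuous_mult (K := R_AbsRing)).
  + apply (continuous_mult (K := R_AbsRing)); [apply continuous_const|].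
    now apply (ex_derive_continuous x).
  + now apply (ex_derive_continuous (Derive x)).
- split; [rewrite <- T0|]; apply Tinc; lra.
- intro t. rewrite !Xal, alper, neg_cos. ring.
- intros t Ht. rewrite Yal, Xal.
  assert (A1 : 0 <= al t) by (apply alge; rewrite T0; lra).
  assert (A2 : al t <= PI / 2) by (apply alle; lra).
  generalize (cos_ge_0 (al t) ltac:(lra) A2) (sin_ge_0 (al t) A1 ltac:(lra)). intros C S.
  generalize (phase_speed_pos (1 / omega) delta (delta * cos (al t)) Hk). intro Q.
  assert (0 <= 2 * delta ^ 2 * (cos (al t) * sin (al t)) *
            phase_speed (1 / omega) delta (delta * cos (al t)))
    by (repeat apply Rmult_le_pos; try apply pow2_ge_0; lra).
  lra.
- intros t Ht. rewrite Yal, Xal.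
  assert (A1 : PI / 2 <= al t) by (apply alge; lra).
  assert (A2 : al t <= PI) by (apply alle; lra).
  generalize (cos_le_0 (al t) A1 ltac:(lra)) (sin_ge_0 (al t) ltac:(lra) A2). intros C S.
  generalize (phase_speed_pos (1 / omega) delta (delta * cos (al t)) Hk). intro Q.
  assert (0 <= 2 * delta ^ 2 * (- cos (al t) * sin (al t)) *
            phase_speed (1 / omega) delta (delta * cos (al t)))
    by (repeat apply Rmult_le_pos; try apply pow2_ge_0; lra).
  lra.
(* Chain rule: the phase speed cancels the denominator in the derivative of [F], leaving sqrt p. *)
- intro t. eapply is_derive_eq.
  + apply (is_derive_comp (V := R_NormedModule) F al); [apply DF | apply Dal'].
  + set (c := delta ^ 2 * cos (al t) ^ 2).
    transitivity (h (al t) * (sqrt (2 * omega) * sqrt ((omega + c) / (2 + delta ^ 2 + c))));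
      [reflexivity|].
    unfold h, phase_speed. rewrite Xal.
    replace ((delta * cos (al t)) ^ 2) with c by (unfold c; ring).
    assert (Hc : 0 <= c) by (apply Rmult_le_pos; apply pow2_ge_0).
    generalize (pow2_ge_0 delta). intro Hd2.
    assert (P1 : 0 <= (omega + c) / (2 + delta ^ 2 + c)) by (apply Rle_mult_inv_pos; lra).
    rewrite <- sqrt_mult by lra.
    rewrite <- sqrt_mult; [f_equal; field; lra| |].
    * apply Rmult_le_pos; lra.
    * apply Rmult_le_pos; lra.
- assert (E0 : x 0 = delta) by (rewrite Xal, al0, cos_0; ring).
  rewrite E0, (Xal (T (PI / 2))), !alT, al0, HF, cos_PI2.
  replace ((omega + delta ^ 2) / _) with (1 + delta ^ 2 / omega) by (field; lra).
  exact Hln.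
Qed.

(** * Time scaling and the theorem *)

(** The substitution t -> c t carries solutions to solutions and keeps their bounds; it reduces the
    modes to the normalised equation. *)
Lemma trivial_solution_stable_rescale (p : R -> R) (c : R) :
  0 < c -> trivial_solution_stable (fun t => c ^ 2 * p (c * t)) -> trivial_solution_stable p.
Proof.
intros Hc Hst xi [H1 H2].
assert (Hx : forall t, is_derive xi t (Derive xi t)) by (intro t; apply Derive_correct, H1).
assert (Hy : forall t, is_derive (Derive xi) t (Derive (Derive xi) t))
  by (intro t; apply Derive_correct, H1).
set (eta := fun t => xi (c * t)).
assert (D1 : forall t, is_derive eta t (c * Derive xi (c * t))).
{ intro t. unfold eta. specialize (Hx (c * t)).
  auto_derive; [eexists; eassumption|]. rewrite_derivatives. ring. }
assert (D2 : forall t, is_derive (Derive eta) t (c * (c * Derive (Derive xi) (c * t)))).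
{ intro t. apply (is_derive_ext (fun t => c * Derive xi (c * t))).
  - intro s. symmetry. apply is_derive_unique, D1.
  - specialize (Hy (c * t)).
    auto_derive; [eexists; eassumption|]. rewrite_derivatives. ring. }
destruct (Hst eta) as [M HM].
- split.
  + intro t. split; [exists (c * Derive xi (c * t)); apply D1 | eexists; apply D2].
  + intro t. change (Derive_n eta 2 t) with (Derive (Derive eta) t).
    rewrite (is_derive_unique _ _ _ (D2 t)). unfold eta.
    specialize (H2 (c * t)). change (Derive_n xi 2 (c * t)) with (Derive (Derive xi) (c * t)) in H2.
    transitivity (c ^ 2 * (Derive (Derive xi) (c * t) + p (c * t) * xi (c * t))); [ring|].
    rewrite H2. ring.
- exists M. intro t. replace (xi t) with (eta (t / c)); [apply HM|].
  unfold eta. f_equal. field. lra.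
Qed.

Lemma duffing_solution_rescale (k delta c : R) (x : R -> R) :
  duffing_solution k delta x -> duffing_solution (c ^ 2 * k) delta (fun t => x (c * t)).
Proof.
intros [Hd [Heq [X0 Y0]]].
assert (Hx : forall t, is_derive x t (Derive x t)) by (intro t; apply Derive_correct, Hd).
assert (Hy : forall t, is_derive (Derive x) t (Derive (Derive x) t))
  by (intro t; apply Derive_correct, Hd).
set (z := fun t => x (c * t)).
assert (D1 : forall t, is_derive z t (c * Derive x (c * t))).
{ intro t. unfold z. specialize (Hx (c * t)).
  auto_derive; [eexists; eassumption|]. rewrite_derivatives. ring. }
assert (D2 : forall t, is_derive (Derive z) t (c * (c * Derive (Derive x) (c * t)))).
{ intro t. apply (is_derive_ext (fun t => c * Derive x (c * t))).
  - intro s. symmetry. apply is_derive_unique, D1.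
  - specialize (Hy (c * t)).
    auto_derive; [eexists; eassumption|]. rewrite_derivatives. ring. }
split; [|split; [|split]].
- intro t. split; [exists (c * Derive x (c * t)); apply D1 | eexists; apply D2].
- intro t. change (Derive_n z 2 t) with (Derive (Derive z) t).
  rewrite (is_derive_unique _ _ _ (D2 t)). unfold z.
  specialize (Heq (c * t)). change (Derive_n x 2 (c * t)) with (Derive (Derive x) (c * t)) in Heq.
  transitivity (c ^ 2 * (Derive (Derive x) (c * t) + k * x (c * t) + k * x (c * t) ^ 3)); [ring|].
  rewrite Heq. ring.
- unfold z. now rewrite Rmult_0_r.
- rewrite (is_derive_unique _ _ _ (D1 0)), Rmult_0_r, Y0. ring.
Qed.

Theorem theorem11 (delta omega : R) (Hdelta : 0 < delta) (Homega : 0 < omega)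
  (Hell : exists l : nat,
     ln (1 + delta ^ 2 / omega) <
     2 * Rmin (Psi delta omega - INR l * PI)
              ((INR l + 1) * PI - Psi delta omega)) :
  (forall Theta_omega : R -> R,
     duffing_solution (1 / omega) delta Theta_omega ->
     trivial_solution_stable (fun t : R => omega + Theta_omega t ^ 2)) /\
  (forall m n : nat, (1 <= m)%nat -> (1 <= n)%nat -> m <> n ->
     omega = INR n ^ 2 / INR m ^ 2 ->
     forall Theta_m : R -> R,
       nonlinear_mode m delta Theta_m -> linearly_stable m n Theta_m).
Proof.
destruct Hell as [l Hl].
assert (Hst : forall Theta_omega : R -> R,
  duffing_solution (1 / omega) delta Theta_omega ->
  trivial_solution_stable (fun t : R => omega + Theta_omega t ^ 2))
  by (intros x Hx; now apply (duffing_hill_stable delta omega x l)).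
split; [exact Hst|].
intros m n Hm Hn _ Ho Theta HTheta.
assert (Pm : 0 < INR m) by (apply lt_0_INR; lia).
assert (Pn : 0 < INR n) by (apply lt_0_INR; lia).
(* This scale gives c^2 m^4 = m^2 / n^2 = 1 / omega in the mode equation, and c^2 n^4 = omega, c^2
   m^2 n^2 = 1 in the Hill equation. *)
set (c := / (INR m * INR n)).
assert (Hc : 0 < c) by (apply Rinv_0_lt_compat; now apply Rmult_lt_0_compat).
apply (trivial_solution_stable_rescale _ c Hc).
apply (duffing_solution_rescale _ _ c) in HTheta.
replace (c ^ 2 * INR m ^ 4) with (1 / omega) in HTheta
  by (rewrite Ho; unfold c; field; lra).
apply Hst in HTheta.
intros xi [Hxi1 Hxi2]. apply HTheta. split; [exact Hxi1|]. intro t.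
rewrite <- (Hxi2 t). rewrite Ho. unfold c. field. lra.
Qed.
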